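(* Let $p$ be a prime, let $\mathcal F$ be a saturated fusion system on a finite $p$-group $S$, and let $P$ be a strongly $\mathcal F$-closed subgroup of $S$. Let $Q,R\le P$ and let $\psi:Q\to R$ be an $\mathcal F$-isomorphism. Then there exist (a) a sequence of isomorphic subgroups $Q=Q_0,Q_1,\ldots,Q_n=R$ of $P$; (b) a sequence of subgroups $S_1,S_2,\ldots,S_n$ of $P$, where each $S_i$ is either an $\mathcal F$-essential subgroup with respect to $P$ or $S_i=P$, such that $Q_{i-1},Q_i\le S_i$ for $i=1,\ldots,n$; (c) automorphisms $\psi_i\in \mathrm{Aut}_{\mathcal F}(S_i)$ such that $(Q_{i-1})\psi_i=Q_i$ for $i=1,\dots,n$ and $\psi=(\psi_1|_{Q_0})\circ(\psi_2|_{Q_1})\circ\cdots\circ(\psi_n|_{Q_{n-1}})$ (maps are written on the right, so $\psi_1$ is applied first).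
   Context: All groups are finite and maps are written on the right. Fusion systems and saturated fusion systems on finite $p$-groups are understood in the standard sense. A subgroup $P\le S$ is strongly $\mathcal F$-closed if for all $x\in P$ and all $\phi\in\mathrm{Hom}_{\mathcal F}(\langle x\rangle,S)$ one has $x\phi\in P$. A subgroup $Q\leq S$ is fully ($\mathcal F$-)normalized if $|N_S(Q)|\ge |N_S(R)|$ for every $\mathcal F$-conjugate $R$ of $Q$. For $D\le T\le G$, $D$ is strongly closed in $T$ with respect to $G$ if $x^g\in D$ whenever $x\in D$, $g\in G$ and $x^g\in T$. Strongly $D$-embedded: let $G$ be a group, $T\in \mathrm{Syl}_p(G)$, and $D>1$ a strongly closed subgroup in $T$ with respect to $G$. A proper subgroup $H<G$ is strongly $D$-embedded in $G$ if (i) $D^x\le H$ for some $x\in G$; and (ii) for all $g\in G\setminus H$, the subgroup $H\cap H^g$ does not contain any $G$-conjugate of any nontrivial subgroup $U$ of $D$. Let $P$ be strongly $\mathcal F$-closed in $S$. A subgroup $Q\le P$ is $\mathcal F$-centric with respect to $P$ if $C_P(Q\psi)\le Q\psi$ for all $\psi\in\mathrm{Hom}_{\mathcal F}(Q,P)$. A proper subgroup $Q<P$ is an $\mathcal F$-essential subgroup with respect to $P$ if (i) $Q$ is $\mathcal F$-centric with respect to $P$; (ii) $Q$ is fully $\mathcal F$-normalized; (iii) $\mathrm{Out}_{\mathcal F}(Q)=\mathrm{Aut}_{\mathcal F}(Q)/\mathrm{Inn}(Q)$ has a strongly $\mathrm{Out}_P(Q)$-embedded subgroup, where $\mathrm{Out}_P(Q)=\mathrm{Aut}_P(Q)/\mathrm{Inn}(Q)$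 and $\mathrm{Aut}_P(Q)$ is the group of automorphisms of $Q$ induced by conjugation by elements of $N_P(Q)$. (For $Q$ fully $\mathcal F$-normalized, $\mathrm{Out}_P(Q)$ is strongly closed in the Sylow $p$-subgroup $\mathrm{Out}_S(Q)$ of $\mathrm{Out}_{\mathcal F}(Q)$ with respect to $\mathrm{Out}_{\mathcal F}(Q)$, so this makes sense.) *)

(* Defs.v *)
From HB Require Import structures.
From mathcomp Require Import all_boot all_fingroup all_solvable.

Set Implicit Arguments.
Unset Strict Implicit.
Unset Printing Implicit Defensive.

Local Open Scope group_scope.

(* The finite group underlying a fusion system is a whole finGroupType S, so  *)
(* {group S} is the type of its subgroups, and 'N(Q), 'C(Q) are N_S(Q),       *)
(* C_S(Q).  A homomorphism with domain Q is represented by a function S -> S  *)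
(* that is only relevant on Q.  Permutations (hence automorphisms) act on the *)
(* right: (a * b) x = b (a x), and x ^ y = y^-1 * x * y.                      *)

Section FusionSystems.

Variable S : finGroupType.
Implicit Types (P Q R T N U : {group S}) (f g : S -> S).

Definition iso_in (hom : {group S} -> {group S} -> pred (S -> S)) Q R f :=
  hom Q R f /\
  exists g, [/\ hom R Q g, {in Q, cancel f g} & {in R, cancel g f}].

(* Inclusions and identities are the case x = 1 of fhom_conj.                 *)
Record fusion_system := FusionSystem {
  fhom :> {group S} -> {group S} -> pred (S -> S);
  fhom_ext : forall Q R f g, {in Q, f =1 g} -> fhom Q R f = fhom Q R g;
  fhom_inj : forall Q R f, fhom Q R f ->
    [/\ morphic Q f, {in Q &, injective f} & f @: Q \subset R];
  fhom_conj : forall Q R (x : S), Q :^ x \subset R -> fhom Q R (conjg^~ x);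
  fhom_comp : forall Q R T f g,
    fhom Q R f -> fhom R T g -> fhom Q T (g \o f);
  fhom_fact : forall Q R f, fhom Q R f ->
    exists2 T : {group S}, T \subset R & iso_in fhom Q T f
}.

Variable F : fusion_system.

Definition fiso Q R f := iso_in F Q R f.

Definition fconj Q R := exists f, fiso Q R f.

Definition AutF Q : {set {perm S}} := [set a in Aut Q | F Q Q a].

Lemma AutF_group_set Q : group_set (AutF Q).
Proof.
apply/group_setP; split.
  apply/setIdP; split; first exact: group1.
  rewrite -(fhom_ext F Q (f := conjg^~ 1)).
    by apply: fhom_conj; rewrite conjsg1.
  by move=> x _; rewrite conjg1 perm1.
move=> a b /setIdP[Aa Fa] /setIdP[Ab Fb]; apply/setIdP.
split; first exact: groupM.
rewrite -(fhom_ext F Q (f := b \o a)) ?(fhom_comp Fa Fb) //.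
by move=> x _; rewrite permM.
Qed.
Canonical AutF_group Q := Group (AutF_group_set Q).

Definition AutBy P Q : {set {perm S}} := conj_aut Q @* 'N_P(Q).
Canonical AutBy_group P Q := [group of AutBy P Q].

Definition Inn Q : {set {perm S}} := conj_aut Q @* Q.
Canonical Inn_group Q := [group of Inn Q].

Definition OutF Q : {set coset_of (Inn Q)} := AutF Q / Inn Q.
Canonical OutF_group Q := [group of OutF Q].

Definition OutBy P Q : {set coset_of (Inn Q)} := AutBy P Q / Inn Q.
Canonical OutBy_group P Q := [group of OutBy P Q].

Definition fully_normalized Q :=
  forall R, fconj Q R -> #|'N(R)| <= #|'N(Q)|.

Definition fully_centralized Q :=
  forall R, fconj Q R -> #|'C(R)| <= #|'C(Q)|.

(* N_f: those y in N_S(Q) for which f^-1 c_y f lies in Aut_S(f @: Q).         *)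
Definition Next Q f : {set S} :=
  [set y in 'N(Q) |
    [exists z in 'N(f @: Q), [forall x in Q, f (x ^ y) == f x ^ z]]].

Lemma Next_group_set Q f : group_set (Next Q f).
Proof.
apply/group_setP; split.
  apply/setIdP; split; first exact: group1.
  apply/exists_inP; exists 1; rewrite ?group1 //.
  by apply/forall_inP=> x _; rewrite !conjg1.
move=> a b /setIdP[Na /exists_inP[c Nc /forall_inP ac]].
case/setIdP=> Nb /exists_inP[d Nd /forall_inP bd].
apply/setIdP; split; first exact: groupM.
apply/exists_inP; exists (c * d); first exact: groupM.
apply/forall_inP=> x Qx.
by rewrite !conjgM -(eqP (ac x Qx)) bd // memJ_norm.
Qed.
Canonical Next_group Q f := Group (Next_group_set Q f).

Definition saturated (p : nat) :=
  (forall Q, fully_normalized Q ->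
     fully_centralized Q /\ p.-Sylow(AutF Q) (AutBy [set: S] Q)) /\
  (forall Q R f, fiso Q R f -> fully_centralized R ->
     exists2 g, F (Next_group Q f) [set: S]%G g & {in Q, g =1 f}).

Definition strongly_Fclosed P :=
  forall x f, x \in P -> F <[x]>%G [set: S]%G f -> f x \in P.

End FusionSystems.

Section StronglyEmbedded.

Variable gT : finGroupType.
Implicit Types G T D H U : {group gT}.

Definition strongly_closed G T D :=
  [/\ D \subset T, T \subset G
    & forall x g, x \in D -> g \in G -> x ^ g \in T -> x ^ g \in D].

Definition strongly_embedded (p : nat) G T D H :=
  [/\ p.-Sylow(G) T, strongly_closed G T D & D :!=: 1] /\
  [/\ H \proper G,
      exists2 x, x \in G & D :^ x \subset H
    & forall g, g \in G :\: H -> forall U, U \subset D -> U :!=: 1 ->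
        forall x, x \in G -> ~~ (U :^ x \subset H :&: H :^ g)].

End StronglyEmbedded.

Section Essential.

Variables (S : finGroupType) (F : fusion_system S).
Implicit Types P Q : {group S}.

Definition Fcentric_wrt P Q :=
  Q \subset P /\ forall f, F Q P f -> 'C_P(f @: Q) \subset f @: Q.

Definition Fessential_wrt (p : nat) P Q :=
  [/\ Q \proper P, Fcentric_wrt P Q, fully_normalized F Q
    & exists H : {group coset_of (Inn Q)},
        strongly_embedded p (OutF_group F Q) (OutBy_group [set: S] Q)
          (OutBy_group P Q) H].

End Essential.

(* Main.v *)
Require Import Defs.
From mathcomp Require Import all_boot all_fingroup all_solvable.

(* Downward induction on #|Q|.  A fully normalized F-conjugate T of Q reduces  *)
(* the claim to maps onto T.  By Sylow's theorem in Aut_F(T), such a map       *)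
(* composed with some automorphism of T extends to N_P(Q) > Q, and it stays    *)
(* in P since P is strongly closed; so only Aut_F(T) remains.  If C_P(T) is    *)
(* not in T, every automorphism extends to T C_P(T) > T.  Otherwise            *)
(* D = Out_P(T) is nontrivial and strongly closed in Out_S(T), and the         *)
(* subgroup K generated by the g in Out_F(T) such that D and D ^ g meet        *)
(* nontrivially is strongly D-embedded unless K = Out_F(T).  In the first case *)
(* T is essential; in the second, each generator lifts to automorphisms of T   *)
(* that extend to a larger subgroup of P.                                      *)

Set Implicit Arguments.
Unset Strict Implicit.
Unset Printing Implicit Defensive.

Local Open Scope group_scope.

(** This is the Alperin-Goldschmidt argument relative to [P]. An element of N_f that lies in [P] but
    not in [Q] gives a proper extension of [f] within [P], which is decomposed by induction
    ([decomp_extend]). Automorphisms of a fully normalized T need more. Since [P] is strongly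
    closed, so is D = Out_P(T) in Out_S(T) ([OutBy_strongly_closed]), and pure group theory
    ([fusing_gen_strongly_embedded]) leaves two cases: T is essential, and its automorphisms are
    allowed as steps, or Out_F(T) is generated by elements taking some nontrivial element of D into
    D, whose lifts have such extensions. [decomp_AutF_fully_normalized] plays this out, and
    [fiso_decomp] reduces every isomorphism to it through [fully_normalized_receptive]. *)

(** * Strongly embedded subgroups from fusion in a strongly closed subgroup *)

Section StronglyEmbedded.

Variables (gT : finGroupType) (p : nat).
Implicit Types G T D : {group gT}.

Definition fusing G D : {set gT} :=
  [set g in G | [exists x in D^#, x ^ g \in D]].

Lemma fusingP G D g :
  reflect [/\ g \in G & exists x, [/\ x \in D, x != 1 & x ^ g \in D]]
          (g \in fusing G D).
Proof.
apply: (iffP setIdP) => [[Gg /exists_inP[x /setD1P[ntx Dx] Dxg]] |].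
  by split=> //; exists x.
case=> Gg [x [Dx ntx Dxg]]; split=> //; apply/exists_inP; exists x => //.
exact/setD1P.
Qed.

(** By strong closure [T] normalizes [D], so [T] lies in H = [<<fusing G D>>] and is Sylow there. If
    H contains [U :^ y] with 1 < U <= D, Sylow's theorem in H moves it into [T], hence into [D],
    which forces [y] into H. A conjugate [U :^ x] inside both H and H^g thus puts x and x g^-1, and
    so g, in H. *)
Lemma fusing_gen_strongly_embedded G T D :
  p.-Sylow(G) T -> strongly_closed G T D -> D :!=: 1 ->
  <<fusing G D>> != G -> strongly_embedded p G T D <<fusing G D>>%G.
Proof.
move=> sylT clD ntD neqG; have [sDT sTG closedD] := clD.
have sDG := subset_trans sDT sTG.
have sHG: <<fusing G D>> \subset G.
  by rewrite gen_subG; apply/subsetP=> g /fusingP[].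
have fusU (U : {group gT}) g : U :!=: 1 -> U \subset D -> g \in G ->
    U :^ g \subset D -> g \in <<fusing G D>>.
  case/trivgPn=> x Ux ntx sUD Gg sUgD; apply/mem_gen/fusingP; split=> //.
  by exists x; split=> //; [apply: (subsetP sUD) | apply: (subsetP sUgD); rewrite memJ_conjg].
have sTH: T \subset <<fusing G D>>.
  apply/subsetP=> t Tt; apply: (fusU D) => //; first exact: (subsetP sTG).
  apply/subsetP=> _ /imsetP[x Dx ->].
  have Tx := subsetP sDT _ Dx.
  by apply: closedD; rewrite ?(subsetP sTG) // groupJ.
have sylTH: p.-Sylow(<<fusing G D>>) T := pHall_subl sTH sHG sylT.
have sub_fus (U : {group gT}) y : U :!=: 1 -> U \subset D -> y \in G ->
    U :^ y \subset <<fusing G D>> -> y \in <<fusing G D>>.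
  move=> ntU sUD Gy sUyH.
  have pUy: p.-group (U :^ y).
    by rewrite pgroupJ (pgroupS sUD) ?(pgroupS sDT) ?(pHall_pgroup sylT).
  have [h Hh sUT] := Sylow_Jsub sylTH (sUyH : (U :^ y)%G \subset _) pUy.
  have Gh := subsetP sHG _ Hh.
  rewrite -(groupMr _ Hh); apply: (fusU U); rewrite ?groupM // conjsgM.
  apply/subsetP=> _ /imsetP[_ /imsetP[x Ux ->] ->].
  rewrite -conjgM; apply: closedD; [exact: (subsetP sUD) | exact: groupM |].
  by apply: (subsetP sUT); rewrite conjgM !memJ_conjg.
split=> //; split.
- by rewrite properEneq neqG.
- by exists 1 => //; rewrite conjsg1 (subset_trans sDT).
move=> g /setDP[Gg notHg] U sUD ntU x Gx; apply: contra notHg.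
rewrite subsetI => /andP[sUxH sUxHg].
have Hx := sub_fus U x ntU sUD Gx sUxH.
rewrite -groupV -(groupMl _ Hx); apply: (sub_fus U) => //.
  by rewrite groupM ?groupV.
by rewrite conjsgM sub_conjgV.
Qed.

End StronglyEmbedded.

(** * Isomorphisms and automizers in a fusion system *)

Section FusionBasics.

Variables (S : finGroupType) (F : fusion_system S).
Implicit Types (P Q R T U N : {group S}) (f g : S -> S).

Lemma fhom_incl Q R : Q \subset R -> F Q R id.
Proof.
move=> sQR; rewrite -(fhom_ext F R (f := conjg^~ 1)) => [|x _]; last exact: conjg1.
by apply: fhom_conj; rewrite conjsg1.
Qed.

Lemma fhom_restr Q R T f : F Q R f -> T \subset Q -> F T R f.
Proof. by move=> Ff sTQ; apply: (fhom_comp (fhom_incl sTQ) Ff). Qed.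

Lemma fiso_im Q R f : fiso F Q R f -> f @: Q = R.
Proof.
case=> Ff [g [Fg fK gK]]; have [_ _ sfR] := fhom_inj Ff.
have [_ _ sgQ] := fhom_inj Fg.
apply/eqP; rewrite eqEsubset sfR; apply/subsetP=> y Ry.
by rewrite -(gK y Ry) imset_f // (subsetP sgQ) ?imset_f.
Qed.

Lemma fhom_fiso Q R f : F Q R f -> exists2 T : {group S}, f @: Q = T & fiso F Q T f.
Proof. by case/fhom_fact=> T _ isof; exists T => //; apply: fiso_im. Qed.

Lemma fisoI Q R f : F Q R f -> f @: Q = R -> fiso F Q R f.
Proof. by case/fhom_fiso=> T -> isof /val_inj <-. Qed.

Lemma fiso_inv Q R f : fiso F Q R f ->
  exists g, [/\ fiso F R Q g, {in Q, cancel f g} & {in R, cancel g f}].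
Proof. by case=> Ff [g [Fg fK gK]]; exists g; split=> //; split=> //; exists f. Qed.

Lemma fiso_card Q R f : fiso F Q R f -> #|Q| = #|R|.
Proof.
by move=> isof; have [/fhom_inj[_ injf _] _] := isof; rewrite -(fiso_im isof) card_in_imset.
Qed.

Lemma fiso_comp Q R T f g :
  fiso F Q R f -> fiso F R T g -> fiso F Q T (g \o f).
Proof.
move=> isof isog; apply: fisoI; first exact: fhom_comp isof.1 isog.1.
by rewrite imset_comp (fiso_im isof) (fiso_im isog).
Qed.

Lemma fiso_ext Q R f g : {in Q, f =1 g} -> fiso F Q R f -> fiso F Q R g.
Proof.
move=> eqfg isof; apply: fisoI; first by rewrite -(fhom_ext F R eqfg) isof.1.
by rewrite -(fiso_im isof) (eq_in_imset eqfg).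
Qed.

Lemma fhomM Q R f : F Q R f -> {in Q &, {morph f : x y / x * y}}.
Proof. by case/fhom_inj=> /morphicP. Qed.

Lemma fhomJ Q R f : F Q R f -> {in Q &, forall x y, f (x ^ y) = f x ^ f y}.
Proof.
case/fhom_inj=> fM _ _ x y Qx Qy.
by rewrite -!(morphmE fM) morphJ.
Qed.

Lemma AutF_fiso Q (a : {perm S}) : a \in AutF F Q -> fiso F Q Q a.
Proof.
case/setIdP=> Aa Fa; apply: fisoI => //.
by have := im_autm Aa; rewrite morphimEdom.
Qed.

Lemma fiso_AutF Q f : fiso F Q Q f ->
  exists2 a, a \in AutF F Q & {in Q, f =1 a}.
Proof.
move=> isof; have [Ff _] := isof; have [fM injf _] := fhom_inj Ff.
have injm_f: 'injm (morphm fM) by apply/injmP.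
have imf: morphm fM @* Q = Q by rewrite morphimEdom; apply: fiso_im.
(* [aut] extends the restriction of [f] to [Q] by the identity outside [Q]. *)
have eq_af: {in Q, f =1 aut injm_f imf} by move=> x Qx; rewrite autE.
by exists (aut injm_f imf) => //; rewrite inE Aut_aut -(fhom_ext F Q eq_af).
Qed.

Lemma conj_aut_AutF Q y : y \in 'N(Q) -> conj_aut Q y \in AutF F Q.
Proof.
move=> Ny; apply/setIdP; split; first by rewrite (subsetP (Aut_conj_aut Q 'N(Q))) ?mem_morphim.
rewrite -(fhom_ext F Q (f := conjg^~ y)) => [|x Qx]; last by rewrite /= norm_conj_autE.
by apply: fhom_conj; rewrite (normP Ny).
Qed.

Lemma AutBy_sub_AutF P Q : AutBy P Q \subset AutF F Q.
Proof.
by apply/subsetP=> _ /morphimP[y Ny _ ->]; apply: conj_aut_AutF.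
Qed.

Lemma Inn_sub_AutBy P Q : Q \subset P -> Inn Q \subset AutBy P Q.
Proof. by move=> sQP; rewrite morphimS // subsetI sQP normG. Qed.

Lemma conj_autJ Q (a : {perm S}) y z : a \in Aut Q -> y \in 'N(Q) -> z \in 'N(Q) ->
  {in Q, forall x, a (x ^ y) = a x ^ z} -> conj_aut Q y ^ a = conj_aut Q z.
Proof.
move=> Aa Ny Nz eqa.
have Ac t: t \in 'N(Q) -> conj_aut Q t \in Aut Q.
  by move=> Nt; rewrite (subsetP (Aut_conj_aut Q 'N(Q))) ?mem_morphim.
apply: (eq_Aut (A := Q)); rewrite ?groupJ ?Ac // => x Qx.
have Qx': a^-1 x \in Q by rewrite Aut_closed ?groupV.
rewrite !permM !norm_conj_autE // eqa //.
by rewrite -permM mulVg perm1.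
Qed.

Lemma conj_autJE Q (a : {perm S}) y z : a \in Aut Q -> y \in 'N(Q) -> z \in 'N(Q) ->
  conj_aut Q y ^ a = conj_aut Q z -> {in Q, forall x, a (x ^ y) = a x ^ z}.
Proof.
move=> Aa Ny Nz eqc x Qx.
by rewrite -(norm_conj_autE Ny Qx) -permM conjgC eqc permM norm_conj_autE ?Aut_closed.
Qed.

(** Conjugating c_y by an automorphism [a] of [Q] gives c_(a y). *)
Lemma Inn_normal_AutF Q : Inn Q <| AutF F Q.
Proof.
rewrite /normal (subset_trans (Inn_sub_AutBy (subxx Q)) (AutBy_sub_AutF _ _)).
apply/subsetP=> a FAa; rewrite inE; have [Aa Fa] := setIdP FAa.
apply/subsetP=> _ /imsetP[_ /morphimP[y Ny Qy ->] ->].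
have Qay: a y \in Q by rewrite Aut_closed.
have Nay := subsetP (normG Q) _ Qay.
rewrite (conj_autJ (z := a y)) ?mem_morphim // => x Qx.
by rewrite (fhomJ Fa).
Qed.

Lemma fully_normalized_exists Q :
  exists R f, fiso F Q R f /\ fully_normalized F R.
Proof.
(* Quantifying over finite functions makes F-conjugacy to [Q] boolean, so that a conjugate with
   largest normalizer can be picked. *)
pose C (R : {group S}) := [exists f : {ffun S -> S}, F Q R f && (f @: Q == R)].
have CP R : reflect (exists f, fiso F Q R f) (C R).
  apply: (iffP existsP) => [[f /andP[Ff /eqP imf]] | [f isof]].
    by exists f; apply: fisoI.
  have isof': fiso F Q R (finfun f).
    by apply: fiso_ext isof => x _; rewrite ffunE.
  by exists (finfun f); rewrite isof'.1 (fiso_im isof') eqxx.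
have CQ: C Q by apply/CP; exists id; apply: fisoI; rewrite ?fhom_incl ?imset_id.
have [T CT maxT] := arg_maxnP (fun R : {group S} => #|'N(R)|) CQ.
have [f isof] := CP _ CT; exists T, f; split=> // U [g isog].
by apply/maxT/CP; exists (g \o f); apply: fiso_comp isof isog.
Qed.

End FusionBasics.

(** * Chains of automorphisms and decomposable maps *)

Section Decomposition.

Variables (p : nat) (S : finGroupType) (F : fusion_system S) (P : {group S}).
Implicit Types (Q R T U N : {group S}) (f g : S -> S) (a b : {perm S}).

(** The steps are permutations of all of [S], so composites and inverses are taken in [{perm S}];
    the leftmost factor acts first, and only the values on the source subgroup matter. *)
Inductive chain : {group S} -> {group S} -> {perm S} -> Prop :=
| ChainNil Q : chain Q Q 1
| ChainCons Q T R U b a :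
    U \subset P -> Fessential_wrt F p P U \/ U = P -> b \in AutF F U ->
    Q \subset U -> b @: Q = T -> chain T R a -> chain Q R (b * a).

Lemma chain_cat Q T R a b : chain Q T a -> chain T R b -> chain Q R (a * b).
Proof.
move=> ch_a ch_b; elim: ch_a ch_b => [? | Q1 T1 R1 U c d sUP essU Fc sQU imc _ IH].
  by rewrite mul1g.
by rewrite -mulgA => /IH; apply: (ChainCons sUP essU Fc sQU imc).
Qed.

Lemma chain_inv Q R a : chain Q R a -> chain R Q a^-1.
Proof.
elim=> [T | Q1 T R1 U b c sUP essU Fb sQU imb _ IH].
  by rewrite invg1; apply: ChainNil.
rewrite invMg; apply: chain_cat IH _; rewrite -[b^-1]mulg1.
have [Ab _] := setIdP Fb.
apply: (ChainCons (U := U) (T := Q1)) => //; last exact: ChainNil; rewrite ?groupV //.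
  by rewrite -imb; apply/subsetP=> _ /imsetP[x Qx ->]; rewrite Aut_closed ?(subsetP sQU).
rewrite -imb -imset_comp (eq_imset (g := id)) ?imset_id // => x /=.
by rewrite -permM mulgV perm1.
Qed.

Lemma chain_restr Q R T a : chain Q R a -> T \subset Q ->
  exists T1 : {group S}, chain T T1 a.
Proof.
move=> ch_a; elim: ch_a T => [Q1 T _ | Q1 T1 R1 U b c sUP essU Fb sQU imb _ IH T sTQ].
  by exists T; apply: ChainNil.
have [Ab _] := setIdP Fb.
have bT: b @: T = autm Ab @* T by rewrite morphimEsub // (subset_trans sTQ).
have [|T2 ch_c] := IH (autm Ab @* T)%G; first by rewrite /= -bT -imb imsetS.
by exists T2; apply: (ChainCons sUP essU Fb (subset_trans sTQ sQU) bT ch_c).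
Qed.

Lemma chain_im Q R a : chain Q R a -> a @: Q = R.
Proof.
elim=> [T | Q1 T R1 U b c _ _ _ _ imb _ imc].
  by rewrite (eq_imset (g := id)) ?imset_id // => x; rewrite perm1.
by rewrite -imc -imb -imset_comp; apply: eq_imset => x; rewrite /= permM.
Qed.

Definition decomp Q R f := exists2 a, chain Q R a & {in Q, f =1 a}.

Lemma decomp_comp Q R T f g :
  decomp Q R f -> decomp R T g -> decomp Q T (g \o f).
Proof.
case=> a ch_a eqfa [b ch_b eqgb]; exists (a * b); first exact: chain_cat ch_b.
move=> x Qx /=; rewrite eqfa // permM eqgb // -(chain_im ch_a).
exact: imset_f.
Qed.

(** The chain for [g] can be run backwards, and [f] is [g \o f] followed by the inverse of [g]. *)
Lemma decomp_cancel Q R T f g :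
  decomp R T g -> decomp Q T (g \o f) -> f @: Q = R -> decomp Q R f.
Proof.
case=> b ch_b eqgb [a ch_a eqgfa] imf; exists (a * b^-1).
  exact: chain_cat ch_a (chain_inv ch_b).
move=> x Qx; rewrite permM -eqgfa //= eqgb -?imf ?imset_f //.
by rewrite -permM mulgV perm1.
Qed.

Lemma decomp_restr Q R f N T g :
  decomp N T g -> Q \subset N -> {in Q, g =1 f} -> f @: Q = R -> decomp Q R f.
Proof.
case=> a ch_a eqga sQN eqgf imf.
have eqfa: {in Q, f =1 a} by move=> x Qx; rewrite -eqgf // eqga // (subsetP sQN).
have [T1 ch_a1] := chain_restr ch_a sQN.
suff -> : R = T1 by exists a.
by apply: val_inj; rewrite /= -imf -(chain_im ch_a1); apply: eq_in_imset.
Qed.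

Lemma decomp_AutF Q a :
  Q \subset P -> Fessential_wrt F p P Q \/ Q = P -> a \in AutF F Q ->
  decomp Q Q a.
Proof.
move=> sQP essQ Fa; exists a => //; rewrite -[a]mulg1.
exact: (ChainCons sQP essQ Fa (subxx Q) (fiso_im (AutF_fiso Fa)) (ChainNil Q)).
Qed.

(** * Extending maps by saturation and strong closure *)

Hypothesis closedP : strongly_Fclosed F P.

Lemma fhom_closed Q R f : F Q R f -> Q \subset P -> f @: Q \subset P.
Proof.
move=> Ff sQP; apply/subsetP=> _ /imsetP[x Qx ->].
apply: closedP; first exact: (subsetP sQP).
have Fx: F <[x]>%G R f by apply: fhom_restr Ff _; rewrite cycle_subG.
by apply: fhom_comp Fx (fhom_incl _ (subsetT R)).
Qed.

Hypothesis satF : saturated F p.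

(** Because of [y], the intersection of N_f with [P] is strictly larger than [Q]. Saturation extends
    [f] to it, the induction hypothesis decomposes the extension, and the chain restricts to [Q]. *)
Lemma decomp_extend Q R f y :
    (forall N T g, #|Q| < #|N| -> N \subset P -> fiso F N T g -> decomp N T g) ->
    Q \subset P -> fiso F Q R f -> fully_centralized F R ->
    y \in Next Q f -> y \in P -> y \notin Q ->
  decomp Q R f.
Proof.
move=> IH sQP isof fcR Ny Py notQy; have [_ extF] := satF.
have [g Fg eqgf] := extF _ _ _ isof fcR.
have imf := fiso_im isof; have [Ff _] := isof.
have sQN: Q \subset Next Q f :&: P.
  rewrite subsetI sQP andbT; apply/subsetP=> x Qx.
  apply/setIdP; split; first exact: (subsetP (normG Q)).
  apply/exists_inP; exists (f x); first by rewrite imf (subsetP (normG R)) // -imf imset_f.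
  by apply/forall_inP=> z Qz; rewrite (fhomJ Ff).
have Fg1: F (Next_group Q f :&: P)%G [set: S]%G g := fhom_restr Fg (subsetIl _ _).
have [T imT isog] := fhom_fiso Fg1.
apply: (decomp_restr (IH _ _ _ _ (subsetIr _ _) isog) sQN eqgf imf).
rewrite proper_card // properE sQN; apply/subsetPn; exists y => //.
by rewrite inE Ny.
Qed.

(** Transport along [f] turns Aut_S(Q) into a p-subgroup of Aut_F(R). As Aut_S(R) is Sylow there,
    some [a] conjugates that subgroup into it, which is what membership in [Next] asks of N_S(Q). *)
Lemma fully_normalized_receptive Q R f : p.-group [set: S] ->
    fiso F Q R f -> fully_normalized F R ->
  exists2 a, a \in AutF F R & 'N(Q) \subset Next Q (a \o f).
Proof.
move=> pS isof fnR; have [[_ sylR] imf] := (satF.1 _ fnR, fiso_im isof).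
have [Ff [g [Fg fK gK]]] := isof.
have [fM injf _] := fhom_inj Ff.
have injm_f: 'injm (morphm fM) by apply/injmP.
have imfQ: morphm fM @* Q = R by rewrite morphimEdom.
(* [phi] is conjugation by [f], from Aut(Q) to Aut(R). *)
pose phi := Aut_isom_morphism injm_f (subxx Q).
pose B := (phi @* AutBy [set: S] Q)%G.
have AcQ y: y \in 'N(Q) -> conj_aut Q y \in Aut Q.
  by move=> Ny; have [] := setIdP (conj_aut_AutF F Ny).
have phiE y x: y \in 'N(Q) -> x \in Q -> phi (conj_aut Q y) (f x) = f (x ^ y).
  move=> Ny Qx; rewrite -(norm_conj_autE Ny Qx).
  exact: (Aut_isomE injm_f (subxx Q) (AcQ y Ny) Qx).
have FphiB y: y \in 'N(Q) -> phi (conj_aut Q y) \in AutF F R.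
  move=> Ny; have [_ FcQ] := setIdP (conj_aut_AutF F Ny).
  apply/setIdP; split; first by rewrite -imfQ; apply: Aut_Aut_isom.
  rewrite -(fhom_ext F R (f := f \o (conj_aut Q y \o g))).
    exact: fhom_comp (fhom_comp Fg FcQ) Ff.
  move=> x; rewrite -imf => /imsetP[z Qz ->] /=.
  by rewrite fK // phiE // norm_conj_autE.
have sBF: B \subset AutF F R.
  by apply/subsetP=> _ /morphimP[_ _ /morphimP[y Ny /setIP[_ NQy] ->] ->]; apply: FphiB.
have pB: p.-group B.
  by rewrite !morphim_pgroup // (pgroupS (subsetT _)).
have [a Fa sBa] := Sylow_Jsub sylR sBF pB.
have [Aa _] := setIdP Fa.
exists a => //; apply/subsetP=> y Ny; apply/setIdP; split=> //.
have Bc: phi (conj_aut Q y) ^ a \in B :^ a.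
  by rewrite memJ_conjg mem_morphim ?AcQ // mem_morphim // inE in_setT.
have /morphimP[z Nz _ eqz] := subsetP sBa _ Bc.
have imaf: (a \o f) @: Q = R by rewrite imset_comp imf (fiso_im (AutF_fiso Fa)).
apply/exists_inP; exists z; first by rewrite imaf.
apply/forall_inP=> x Qx /=; have Rfx: f x \in R by rewrite -imf imset_f.
by rewrite -phiE // -permM conjgC eqz permM norm_conj_autE // Aut_closed.
Qed.

(** The inverse of an isomorphism from [R] to T <= P extends to a map g whose domain contains T and
    C_S(T). It sends C_P(T) into C_P(R) <= R = g(T), so injectivity gives C_P(T) <= T. *)
Lemma fully_centralized_centric R : fully_centralized F R -> R \subset P ->
  'C_P(R) \subset R -> Fcentric_wrt F P R.
Proof.
move=> fcR sRP sCR; split=> // f Ff; have [T imf isof] := fhom_fiso Ff.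
rewrite imf; apply/subsetP=> y /setIP[Py Cy].
have [h [isoh fK hK]] := fiso_inv isof.
have [g Fg eqgh] := satF.2 _ _ _ isoh fcR.
have imh := fiso_im isoh.
have TN x: x \in T -> x \in Next T h.
  move=> Tx; apply/setIdP; split; first exact: (subsetP (normG T)).
  apply/exists_inP; exists (h x); first by rewrite imh (subsetP (normG R)) // -imh imset_f.
  by apply/forall_inP=> z Tz; rewrite (fhomJ isoh.1).
have Ny: y \in Next T h.
  apply/setIdP; split; first exact: (subsetP (cent_sub T)).
  apply/exists_inP; exists 1; rewrite ?group1 //.
  by apply/forall_inP=> z Tz; rewrite conjg1 conjgE -(centP Cy) ?mulKg.
have Rgy: g y \in R.
  apply: (subsetP sCR); apply/setIP; split.
    apply: closedP => //; apply: fhom_restr Fg _; by rewrite cycle_subG.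
  apply/centP=> r; rewrite -imh => /imsetP[t Tt ->]; rewrite -eqgh //.
  have Nt := TN t Tt.
  by rewrite /commute -!(fhomM Fg) // (centP Cy).
have [_ injg _] := fhom_inj Fg.
move: Rgy; rewrite -imh => /imsetP[t Tt]; rewrite -eqgh // => /injg -> //.
exact: TN.
Qed.

Lemma AutBy_Next R a y : a \in AutF F R -> y \in 'N(R) ->
  conj_aut R y ^ a \in AutBy [set: S] R -> y \in Next R a.
Proof.
move=> Fa Ny /morphimP[z Nz _ eqz]; have [Aa _] := setIdP Fa.
apply/setIdP; split=> //; rewrite (fiso_im (AutF_fiso Fa)).
apply/exists_inP; exists z => //; apply/forall_inP=> x Rx.
by rewrite (conj_autJE Aa Ny Nz eqz).
Qed.

(* The conjugating element z with c_y ^ a = c_z need not lie in P, but c_y ^ a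
   is also induced by the image of y under an extension of a to N_a. *)
Lemma AutBy_closed R a y : fully_normalized F R -> a \in AutF F R ->
    y \in 'N_P(R) -> conj_aut R y ^ a \in AutBy [set: S] R ->
  conj_aut R y ^ a \in AutBy P R.
Proof.
move=> fnR Fa /setIP[Py Ny] Sya; have [fcR _] := satF.1 _ fnR.
have [Aa _] := setIdP Fa; have isoa := AutF_fiso Fa.
have Nay := AutBy_Next Fa Ny Sya.
have [g Fg eqga] := satF.2 _ _ _ isoa fcR.
have RN x: x \in R -> x \in Next R a.
  move=> Rx; have Nx := subsetP (normG R) _ Rx.
  have Nax: a x \in 'N(R) by rewrite (subsetP (normG R)) ?Aut_closed.
  have axJ: {in R, forall z, a (z ^ x) = a z ^ a x}.
    by move=> z Rz; rewrite (fhomJ isoa.1).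
  apply: AutBy_Next => //; rewrite (conj_autJ Aa Nx Nax axJ).
  by rewrite mem_morphim // inE in_setT.
have agJ: {in R, forall x, a (x ^ y) = a x ^ g y}.
  move=> x Rx; rewrite -!eqga ?memJ_norm //.
  by rewrite (fhomJ Fg) //; apply: RN.
have Ngy: g y \in 'N(R).
  rewrite inE; apply/subsetP=> _ /imsetP[r Rr ->].
  move: Rr; rewrite -{1}(fiso_im isoa) => /imsetP[x Rx ->].
  by rewrite -agJ // Aut_closed // memJ_norm.
rewrite (conj_autJ Aa Ny Ngy agJ) mem_morphim // inE Ngy andbT.
by apply: closedP => //; apply: fhom_restr Fg _; rewrite cycle_subG.
Qed.

(** * Outer automorphism groups *)

Lemma AutF_norm_Inn R a : a \in AutF F R -> a \in 'N(Inn R).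
Proof. exact/subsetP/normal_norm/Inn_normal_AutF. Qed.

Lemma mem_OutBy N R a : R \subset N -> a \in AutF F R ->
  (coset (Inn R) a \in OutBy N R) = (a \in AutBy N R).
Proof.
move=> sRN Fa; have nsIN: Inn R <| AutBy N R.
  exact: normalS (Inn_sub_AutBy sRN) (AutBy_sub_AutF F N R) (Inn_normal_AutF F R).
by rewrite -[in RHS](quotientGK nsIN) in_setI (AutF_norm_Inn Fa) inE.
Qed.

Lemma OutByP N R u : u \in OutBy N R ->
  exists2 y, y \in 'N_N(R) & u = coset (Inn R) (conj_aut R y).
Proof. by case/morphimP=> _ _ /morphimP[y _ NNy ->] ->; exists y. Qed.

(** Aut_P(R) and Aut_S(R) both contain Inn(R), so membership modulo Inn(R) is membership of
    representatives, and [AutBy_closed] applies. *)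
Lemma OutBy_strongly_closed R : R \subset P -> fully_normalized F R ->
  strongly_closed (OutF_group F R) (OutBy_group [set: S] R) (OutBy_group P R).
Proof.
move=> sRP fnR; split=> [||u v].
- by rewrite quotientS // morphimS // setSI // subsetT.
- exact/quotientS/AutBy_sub_AutF.
case/OutByP=> y NPy -> /morphimP[a NIa Fa ->].
have [_ Ny] := setIP NPy; have Fy := conj_aut_AutF F Ny.
have NIy := AutF_norm_Inn Fy.
have Fya: conj_aut R y ^ a \in AutF F R by rewrite groupJ.
rewrite -morphJ // !mem_OutBy ?subsetT //.
exact: AutBy_closed.
Qed.

(** Normalizers grow in the p-group [P]. If y in N_P(R) outside [R] acted on [R] as some r in [R],
    then y r^-1 would lie in C_P(R) <= R. *)
Lemma OutBy_neq1 R : p.-group [set: S] -> R \proper P -> 'C_P(R) \subset R ->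
  OutBy P R != 1.
Proof.
move=> pS prRP sCR; have [sRP _] := andP prRP.
have nilP: nilpotent P := pgroup_nil (pgroupS (subsetT P) pS).
have [_ [y NPy notRy]] := properP (nilpotent_proper_norm nilP prRP).
have [Py Ny] := setIP NPy; have Fy := conj_aut_AutF F Ny.
have NIy := AutF_norm_Inn Fy.
apply/trivgPn; exists (coset (Inn R) (conj_aut R y)).
  by rewrite mem_OutBy // mem_morphim.
apply: contra notRy => /eqP/(coset_idr NIy)/morphimP[r Nr Rr eqyr].
have Py' := groupM Py (groupVr (subsetP sRP _ Rr)).
rewrite -(groupMr y (groupVr Rr)) (subsetP sCR) // inE Py' -ker_conj_aut.
apply/kerP; first exact: groupM (groupVr Nr).
by rewrite morphM ?groupV // morphV // -eqyr mulgV.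
Qed.

(** * The induction: automorphisms of fully normalized subgroups, then all isomorphisms *)

Lemma decomp_AutF_fully_normalized R a :
    p.-group [set: S] ->
    (forall N T g, #|R| < #|N| -> N \subset P -> fiso F N T g -> decomp N T g) ->
    R \proper P -> fully_normalized F R -> a \in AutF F R ->
  decomp R R a.
Proof.
move=> pS IH prRP fnR Fa; have [sRP _] := andP prRP.
have [fcR sylR] := satF.1 _ fnR.
have extend b y : b \in AutF F R -> y \in Next R b -> y \in P -> y \notin R ->
    decomp R R b.
  by move=> Fb; apply: decomp_extend => //; apply: AutF_fiso.
have [sCR | /subsetPn[y /setIP[Py Cy] notRy]] := boolP ('C_P(R) \subset R); last first.
  apply: (extend a y) => //; apply/setIdP; split.
    exact: (subsetP (cent_sub R)).
  apply/exists_inP; exists 1; rewrite ?group1 //.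
  by apply/forall_inP=> x Rx; rewrite conjg1 conjgE -(centP Cy) ?mulKg.
have nIF := normal_norm (Inn_normal_AutF F R).
have ntO := OutBy_neq1 pS prRP sCR.
have sylO: p.-Sylow(OutF F R) (OutBy [set: S] R).
  exact: quotient_pHall (subset_trans (AutBy_sub_AutF F _ _) nIF) sylR.
pose K := fusing (OutF_group F R) (OutBy_group P R).
have [genK | neqK] := eqVneq <<K>> (OutF F R); last first.
  apply: decomp_AutF => //; left; split=> //.
    exact: fully_centralized_centric.
  exists <<K>>%G; apply: fusing_gen_strongly_embedded => //.
  exact: OutBy_strongly_closed.
(* A nontrivial element of Out_P(R) sent into Out_P(R) by [b] is the class of some c_y with [y] in
   N_P(R). Then [y] lies in N_b, and not in [R] because the class is nontrivial. *)
have decK b : b \in AutF F R -> coset (Inn R) b \in K -> decomp R R b.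
  move=> Fb /fusingP[_ [u [/OutByP[y NPy ->] nty]]].
  have [Py Ny] := setIP NPy; have Fy := conj_aut_AutF F Ny.
  have [NIy NIb] := (AutF_norm_Inn Fy, AutF_norm_Inn Fb).
  have Fyb: conj_aut R y ^ b \in AutF F R by rewrite groupJ.
  rewrite -morphJ // mem_OutBy // => Pyb.
  apply: (extend b y) => //.
    by apply: AutBy_Next => //; apply: subsetP Pyb; rewrite morphimS // setSI ?subsetT.
  apply: contra nty => Ry; apply/eqP/coset_id.
  by rewrite mem_morphim.
(* This settles the empty product below, where [a] is inner but possibly not the identity. *)
have K1: 1 \in K.
  have [u Ou ntu] := trivgPn _ ntO.
  by apply/fusingP; split; [apply: group1 | exists u; rewrite conjg1].
have: coset (Inn R) a \in <<K>> by rewrite genK mem_quotient.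
case/gen_prodgP=> n [c Kc]; elim: n c Kc a Fa => [|n IHn] c Kc a Fa.
  by rewrite big_ord0 => a1; apply: decK; rewrite ?a1.
have /morphimP[b NIb Fb def_b]: c ord_max \in OutF F R by rewrite -genK mem_gen.
rewrite big_ord_recr /= => def_a.
(* Dividing by a lift of the last generator shortens the product by one; any lift will do, since
   [decK] depends only on the coset. *)
have ab: decomp R R (a * b^-1).
  apply: (IHn (fun i => c (widen_ord (leqnSn n) i))); rewrite ?groupM ?groupV //.
  by rewrite morphM ?groupV ?morphV ?AutF_norm_Inn //= def_a def_b mulgK.
have Kb: coset (Inn R) b \in K by rewrite -def_b.
have [d ch_d eqd] := decomp_comp ab (decK b Fb Kb).
by exists d => // x Rx; rewrite -eqd //= -permM mulgKV.
Qed.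

Lemma fiso_decomp Q R f :
  p.-group [set: S] -> Q \subset P -> fiso F Q R f -> decomp Q R f.
Proof.
move=> pS; have [m] := ubnP (#|P| - #|Q|).
elim: m => // m IHm in Q R f * => /ltnSE-le_m sQP isof.
have [eqQP | neqQP] := eqVneq Q P.
  subst Q; have sRP: R \subset P by rewrite -(fiso_im isof) (fhom_closed isof.1).
  have defR: R = P.
    by apply/eqP; rewrite -val_eqE eqEcard sRP (fiso_card isof) /=.
  subst R; have [a Fa eqfa] := fiso_AutF isof.
  have [d ch_d eqd] := decomp_AutF (subxx P) (or_intror erefl) Fa.
  by exists d => // x Px; rewrite eqfa ?eqd.
have prP Q1 : Q1 \subset P -> #|Q1| = #|Q| -> Q1 \proper P.
  move=> sQ1P eqQ1; rewrite properEcard sQ1P eqQ1.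
  by rewrite proper_card // properEneq sQP neqQP.
have prQP := prP Q sQP erefl.
have IH N T g : #|Q| < #|N| -> N \subset P -> fiso F N T g -> decomp N T g.
  move=> ltQN sNP; apply: IHm => //; apply: leq_trans le_m.
  by rewrite ltn_sub2l // proper_card.
(* For a suitable [a] in Aut_F(T), [a \o g] extends to N_P(Q1) > Q1; [a] is decomposed separately
   and cancelled. *)
have to_fn Q1 T g : #|Q1| = #|Q| -> Q1 \subset P -> fiso F Q1 T g ->
    fully_normalized F T -> decomp Q1 T g.
  move=> eqQ1 sQ1P isog fnT; have prQ1P := prP _ sQ1P eqQ1.
  have eqT: #|T| = #|Q| by rewrite -(fiso_card isog).
  have sTP: T \subset P by rewrite -(fiso_im isog) (fhom_closed isog.1).
  have [a Fa sN] := fully_normalized_receptive pS isog fnT.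
  have nilP: nilpotent P := pgroup_nil (pgroupS (subsetT P) pS).
  have [_ [y /setIP[Py Ny] notQy]] := properP (nilpotent_proper_norm nilP prQ1P).
  apply: (@decomp_cancel _ T T g a); last exact: fiso_im isog.
    apply: decomp_AutF_fully_normalized => //; first by rewrite eqT.
    exact: prP.
  apply: (decomp_extend (y := y)) => //; first by rewrite eqQ1.
  - exact: fiso_comp isog (AutF_fiso Fa).
  - by have [] := satF.1 _ fnT.
  - exact: (subsetP sN).
have sRP: R \subset P by rewrite -(fiso_im isof) (fhom_closed isof.1).
(* Both [g] and [g \o f] end at the fully normalized [T], so [to_fn] decomposes them and cancelling
   [g] leaves [f]. *)
have [T [g [isog fnT]]] := fully_normalized_exists F R.
apply: (decomp_cancel (T := T) (g := g)); last exact: fiso_im isof.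
  by apply: to_fn; rewrite // (fiso_card isof).
by apply: to_fn => //; apply: fiso_comp isof isog.
Qed.

End Decomposition.

(** * Reading a chain as indexed sequences *)

Section ChainSequence.

Variables (p : nat) (S : finGroupType) (F : fusion_system S) (P : {group S}).

Lemma chain_sequence (Q R : {group S}) a : chain p F P Q R a -> Q \subset P ->
  exists (n : nat) (Q_ S_ : nat -> {group S}) (psi_ : nat -> {perm S}),
    [/\ Q_ 0 = Q /\ Q_ n = R,
        forall i, i <= n -> Q_ i \subset P /\ Q \isog Q_ i,
        forall i, 0 < i <= n ->
          [/\ S_ i \subset P, Fessential_wrt F p P (S_ i) \/ S_ i = P,
              Q_ i.-1 \subset S_ i & Q_ i \subset S_ i],
        forall i, 0 < i <= n ->
          psi_ i \in AutF F (S_ i) /\ psi_ i @: Q_ i.-1 = Q_ i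
      & a = \prod_(1 <= i < n.+1) psi_ i].
Proof.
elim=> {Q R a} [Q sQP | Q T R U b a sUP essU Fb sQU imb _ IH sQP].
  exists 0, (fun=> Q), (fun=> P), (fun=> 1); split=> //; try by case=> [|i].
    by move=> i _; split; rewrite ?isog_refl.
  by rewrite big_geq.
have [Ab _] := setIdP Fb.
have sTU: T \subset U.
  by rewrite -imb; apply/subsetP=> _ /imsetP[x Qx ->]; rewrite Aut_closed ?(subsetP sQU).
have isoQT: Q \isog T.
  have ->: (T : {set S}) = autm Ab @* Q by rewrite morphimEsub.
  by rewrite sub_isog ?injm_autm.
have [n [Q_ [S_ [psi_ [[Q0 Qn] sQ_P sQS F_psi def_a]]]]] := IH (subset_trans sTU sUP).
(* The new step gets index 1 and the old ones move up by one; [S_] and [psi_] take dummy values at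
   index 0. *)
exists n.+1, (fun i => if i is j.+1 then Q_ j else Q).
exists (fun i => if i is j.+2 then S_ j.+1 else U).
exists (fun i => if i is j.+2 then psi_ j.+1 else b).
split=> //.
- case=> [|i] le_in; first by rewrite isog_refl.
  by have [sQ isoTQ] := sQ_P i le_in; split=> //; apply: isog_trans isoTQ.
- by case=> [|[|i]] //= le_in; [rewrite Q0 | apply: (sQS i.+1)].
- by case=> [|[|i]] //= le_in; [rewrite Q0 | apply: (F_psi i.+1)].
rewrite big_ltn // big_add1 /= def_a; congr (_ * _).
by apply: eq_big_nat => -[].
Qed.

End ChainSequence.

Theorem theorem1 (p : nat) (S : finGroupType) (F : fusion_system S)
    (P Q R : {group S}) (psi : S -> S) :
  prime p -> (p.-group [set: S])%g -> saturated F p -> strongly_Fclosed F P ->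
  Q \subset P -> R \subset P -> fiso F Q R psi ->
  exists (n : nat) (Q_ S_ : nat -> {group S}) (psi_ : nat -> {perm S}),
    [/\ Q_ 0 = Q /\ Q_ n = R,
        forall i, i <= n -> Q_ i \subset P /\ (Q \isog Q_ i)%g,
        forall i, 0 < i <= n ->
          [/\ S_ i \subset P, Fessential_wrt F p P (S_ i) \/ S_ i = P,
              Q_ i.-1 \subset S_ i & Q_ i \subset S_ i],
        forall i, 0 < i <= n ->
          psi_ i \in AutF F (S_ i) /\ psi_ i @: Q_ i.-1 = Q_ i
      & forall x, x \in Q -> psi x = (\prod_(1 <= i < n.+1) psi_ i)%g x].
Proof.
move=> _ pS satF closedP sQP _ isopsi.
have [a ch_a eqa] := fiso_decomp closedP satF pS sQP isopsi.
have [n [Q_ [S_ [psi_ [? ? ? ? def_a]]]]] := chain_sequence ch_a sQP.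
by exists n, Q_, S_, psi_; split=> // x Qx; rewrite eqa // def_a.
Qed.
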